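(* Let $K$ be a finite set of market participants. For each $k\in K$ let $c_k$ be a real vector, $A_k,B_k$ real matrices and $b_k$ a real vector of compatible dimensions (all $A_k$ having the same number of rows). Consider the welfare maximisation linear program over $x=(x_k)_{k\in K}$: $$\max_x \sum_{k} c_k^T x_k \quad\text{s.t.}\quad \sum_k A_k x_k = 0\ [\pi],\qquad B_k x_k\le b_k\ \ \forall k\in K .$$ Assume that the involved feasible sets (that of this program, and the sets $\{x_k : B_kx_k\le b_k\}$ for each $k$) are non-empty and bounded. Let $(x_k^* )_{k\in K}$ be an optimal solution of this program, and let $\pi^*$ be obtained as linear programming optimal dual variables to the balance constraints $\sum_k A_kx_k=0$. Then $(x_k^* )_{k\in K}$ and $\pi^*$ form a competitive equilibrium.
   Context: Competitive (or Walrasian) equilibrium: decisions $(x_k^* )_{k\in K}$ and prices $\pi^*$ form a competitive equilibrium if (i) for each $k\in K$, for the given fixed prices $\pi^*$, $x_k^*$ solves $\max_{x_k}\ c_k^Tx_k-(\pi^* )^T(A_kx_k)$ subject to $B_kx_k\le b_k$; and (ii) the market clears: $\sum_k A_kx_k^*=0$. Dual variables (sign convention): the linear programming dual of the welfare maximisation program is $\min_{\pi,(\sigma_k)} \sum_k b_k^T\sigma_k$ subject to $A_k^T\pi+B_k^T\sigma_k=c_k$ and $\sigma_k\ge 0$ for all $k$, with $\pi$ free. Optimal dual variables $\pi^*$ to the balance constraints are the $\pi$-component of an optimal solution of this dual. *)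

(* Defs.v *)
From mathcomp Require Import all_boot all_order all_algebra.
From mathcomp Require Import classical_sets reals topology normedtype.

Import Order.TTheory GRing.Theory Num.Theory.
Import numFieldNormedType.Exports.
Local Open Scope classical_set_scope.
Local Open Scope ring_scope.

Definition dot {R : realType} {n : nat} (u v : 'cV[R]_n) : R :=
  (u^T *m v) 0 0.

Definition vle {R : realType} {n : nat} (u v : 'cV[R]_n) : Prop :=
  forall i, u i 0 <= v i 0.

Definition is_max {R : realType} {T : Type} (f : T -> R) (S : set T) (x : T) :
  Prop := S x /\ forall y, S y -> f y <= f x.

Definition is_min {R : realType} {T : Type} (f : T -> R) (S : set T) (x : T) :
  Prop := S x /\ forall y, S y -> f x <= f y.

(* Participant k has its own numbers nvar k of variables and ncon k of private
   constraints; m is the number of balance constraints, common to all. *)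
Record market (R : realType) (K : finType) (m : nat) := Market {
  nvar : K -> nat;
  ncon : K -> nat;
  coef_c : forall k, 'cV[R]_(nvar k);
  mx_A : forall k, 'M[R]_(m, nvar k);
  mx_B : forall k, 'M[R]_(ncon k, nvar k);
  rhs_b : forall k, 'cV[R]_(ncon k) }.

Arguments nvar {R K m}.
Arguments ncon {R K m}.
Arguments coef_c {R K m}.
Arguments mx_A {R K m}.
Arguments mx_B {R K m}.
Arguments rhs_b {R K m}.

Definition decision {R : realType} {K : finType} {m : nat}
  (M : market R K m) : Type := forall k, 'cV[R]_(nvar M k).

Definition multiplier {R : realType} {K : finType} {m : nat}
  (M : market R K m) : Type := forall k, 'cV[R]_(ncon M k).

Definition private_feasible {R : realType} {K : finType} {m : nat}
  (M : market R K m) (k : K) : set 'cV[R]_(nvar M k) :=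
  [set x | vle (mx_B M k *m x) (rhs_b M k)].

Definition balanced {R : realType} {K : finType} {m : nat}
  (M : market R K m) (x : decision M) : Prop :=
  \sum_k mx_A M k *m x k = 0.

Definition welfare_feasible {R : realType} {K : finType} {m : nat}
  (M : market R K m) : set (decision M) :=
  [set x | balanced M x /\ forall k, private_feasible M k (x k)].

Definition welfare {R : realType} {K : finType} {m : nat}
  (M : market R K m) (x : decision M) : R :=
  \sum_k dot (coef_c M k) (x k).

Definition dual_feasible {R : realType} {K : finType} {m : nat}
  (M : market R K m) : set ('cV[R]_m * multiplier M) :=
  [set d | forall k, (mx_A M k)^T *m d.1 + (mx_B M k)^T *m d.2 k = coef_c M k
                     /\ vle 0 (d.2 k)].

Definition dual_objective {R : realType} {K : finType} {m : nat}
  (M : market R K m) (d : 'cV[R]_m * multiplier M) : R :=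
  \sum_k dot (rhs_b M k) (d.2 k).

Definition optimal_balance_dual {R : realType} {K : finType} {m : nat}
  (M : market R K m) (p : 'cV[R]_m) : Prop :=
  exists s : multiplier M,
    is_min (dual_objective M) (dual_feasible M) (p, s).

Definition participant_profit {R : realType} {K : finType} {m : nat}
  (M : market R K m) (p : 'cV[R]_m) (k : K) (x : 'cV[R]_(nvar M k)) : R :=
  dot (coef_c M k) x - dot p (mx_A M k *m x).

Definition competitive_equilibrium {R : realType} {K : finType} {m : nat}
  (M : market R K m) (x : decision M) (p : 'cV[R]_m) : Prop :=
  (forall k, is_max (participant_profit M p k) (private_feasible M k)
                    (x k))
  /\ balanced M x.

(* Boundedness in the finite product of the spaces 'cV[R]_(nvar M k), for the
   maximum of the norms of the components. *)
Definition bounded_decisions {R : realType} {K : finType} {m : nat}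
  (M : market R K m) (S : set (decision M)) : Prop :=
  exists C : R, forall x, S x -> forall k, `|x k| <= C.

(* Main.v *)
Require Import Defs.
From mathcomp Require Import all_boot all_order all_algebra.
From mathcomp Require Import classical_sets reals topology normedtype.
From mathcomp Require Import boolp ring lra.

Import Order.TTheory GRing.Theory Num.Theory.
Import numFieldNormedType.Exports.
Local Open Scope classical_set_scope.
Local Open Scope ring_scope.

(** Linear programming duality is Farkas' lemma for the homogenised program: in
    the variables [(d, t)], the inequalities [A d = 0], [B d <= t b], [0 <= t]
    imply [c d <= t w] when [w] is the optimal value, and the multipliers that
    witness this implication form a dual solution of value at most [w]. Hence
    an optimal dual solution [(p, s)] has value at most [w] as well. By weak
    duality, [b_k s_k] bounds the profit of participant [k] at prices [p], and
    these bounds add up to at most [w], which is the total profit at [x] because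
    [x] is balanced; so [x_k] attains the bound for every [k]. *)

(** * Farkas' lemma for finitely many linear forms on a module *)

Section Farkas.
Variables (R : realFieldType) (V : lmodType R).

Lemma scalar_scale (f : V -> R) a x : scalar f -> f (a *: x) = a * f x.
Proof.
move=> fL; have f0 : f 0 = 0 by have := fL 1 0 0; rewrite scaler0 addr0; lra.
by have := fL a x 0; rewrite addr0 f0 addr0.
Qed.

Lemma scalar_subZ (f : V -> R) x a y : scalar f -> f (x - a *: y) = f x - a * f y.
Proof. by move=> fL; rewrite addrC -scaleNr fL; ring. Qed.

Lemma scalar_projection (f g : V -> R) (v : V) :
  scalar f -> scalar g -> scalar (fun x => f (x - g x *: v)).
Proof. by move=> fL gL a x y; rewrite !(scalar_subZ f) // fL gL; ring. Qed.

(* Induction on the number of constraints (Bartl): a new constraint [a j] that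
   is needed is positive at some [v] satisfying the others, and projecting
   along [v] onto the kernel of [a j] reduces to the remaining ones. *)
Lemma farkas_seq (J : eqType) (r : seq J) (a : J -> V -> R) (g : V -> R) :
    uniq r -> (forall j, scalar (a j)) -> scalar g ->
    (forall x, (forall j, j \in r -> a j x <= 0) -> g x <= 0) ->
  exists2 l : J -> R, (forall j, 0 <= l j) &
    forall x, g x = \sum_(j <- r) l j * a j x.
Proof.
elim: r a g => [|j r IHr] a g /=.
  move=> _ _ gL g_le0; exists (fun=> 0) => // x; rewrite big_nil.
  have gN : g (- x) = - g x by rewrite -scaleN1r scalar_scale // mulN1r.
  have := g_le0 x (fun=> ltac:(done)); have := g_le0 (- x) (fun=> ltac:(done)).
  by rewrite gN; lra.
move=> /andP[jr r_uniq] aL gL g_le0.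
(* If the constraints in [r] alone already force [g x <= 0], then [a j] gets multiplier [0]. *)
have [g_le0r|] := pselect (forall x, (forall i, i \in r -> a i x <= 0) -> g x <= 0).
  have [l l_ge0 gE] := IHr a g r_uniq aL gL g_le0r.
  exists (fun i => if i == j then 0 else l i) => [i|x]; first by case: ifP.
  rewrite big_cons eqxx mul0r add0r gE; apply: eq_big_seq => i ir.
  by case: eqP => // ij; rewrite -ij ir in jr.
move=> /existsNP[u /not_implyP[au_le0 /negP]]; rewrite -ltNge => gu_gt0.
have aju_gt0 : 0 < a j u.
  rewrite ltNge; apply/negP => aju; suff: g u <= 0 by rewrite leNgt gu_gt0.
  by apply: g_le0 => i; rewrite inE => /predU1P[->//|/au_le0].
pose v := (a j u)^-1 *: u.
have ajv : a j v = 1 by rewrite scalar_scale // mulVf ?gt_eqF.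
have av_le0 i : i \in r -> a i v <= 0.
  by move=> /au_le0 ?; rewrite scalar_scale // pmulr_rle0 ?invr_gt0.
have gv_ge0 : 0 <= g v by rewrite scalar_scale // mulr_ge0 ?ltW ?invr_gt0.
(* Since [a j v = 1], the point [x - a j x *: v] satisfies the constraint [a j] with equality, so
   only those in [r] remain to be assumed. *)
have [||x ax_le0|l l_ge0 gE] := IHr (fun i x => a i (x - a j x *: v))
    (fun x => g (x - a j x *: v)) r_uniq.
- by move=> i; apply: scalar_projection.
- exact: scalar_projection.
- apply: g_le0 => i; rewrite inE => /predU1P[->|/ax_le0//].
  by rewrite scalar_subZ // ajv mulr1 subrr.
(* The multiplier of [a j] is the coefficient of [a j x] once [gE] is expanded; it is nonnegative
   because [g v] is and every [a i v] is nonpositive. *)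
exists (fun i => if i == j then g v - \sum_(i <- r) l i * a i v else l i).
  move=> i; case: ifP => // _; rewrite subr_ge0 (le_trans _ gv_ge0)//.
  by rewrite big_seq; apply: sumr_le0 => k /av_le0; apply: mulr_ge0_le0.
move=> x; rewrite big_cons eqxx.
rewrite [X in _ + X](eq_big_seq (fun i => l i * a i x)); last first.
  by move=> i ir; case: eqP => // ij; rewrite -ij ir in jr.
have := gE x; rewrite scalar_subZ //.
under [X in _ = X -> _]eq_bigr do rewrite scalar_subZ // mulrBr mulrCA.
rewrite sumrB -mulr_sumr; lra.
Qed.

Lemma farkas (J : finType) (a : J -> V -> R) (g : V -> R) :
    (forall j, scalar (a j)) -> scalar g ->
    (forall x, (forall j, a j x <= 0) -> g x <= 0) ->
  exists2 l : J -> R, (forall j, 0 <= l j) &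
    forall x, g x = \sum_j l j * a j x.
Proof.
move=> aL gL g_le0; apply: farkas_seq => //; first exact: index_enum_uniq.
by move=> x ax; apply: g_le0 => j; apply: ax; rewrite mem_index_enum.
Qed.

End Farkas.

(** * Weak and strong duality for the welfare program *)

Section Duality.
Variable R : realType.

Lemma dotE n (u v : 'cV[R]_n) : dot u v = \sum_i u i 0 * v i 0.
Proof. by rewrite /dot mxE; apply: eq_bigr => i _; rewrite mxE. Qed.

Lemma dotC n (u v : 'cV[R]_n) : dot u v = dot v u.
Proof. by rewrite !dotE; apply: eq_bigr => i _; rewrite mulrC. Qed.

Lemma dot_is_scalar n (u : 'cV[R]_n) : scalar (dot u).
Proof. by move=> a v w; rewrite /dot mulmxDr -scalemxAr !mxE. Qed.

Lemma dotr0 n (u : 'cV[R]_n) : dot u 0 = 0.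
Proof. by rewrite /dot mulmx0 mxE. Qed.

Lemma dotDl n (u v w : 'cV[R]_n) : dot (u + v) w = dot u w + dot v w.
Proof. by rewrite /dot linearD mulmxDl mxE. Qed.

Lemma dot_trmx n q (B : 'M[R]_(q, n)) s v : dot (B^T *m s) v = dot s (B *m v).
Proof. by rewrite /dot trmx_mul trmxK mulmxA. Qed.

Lemma dot_sumr (K : finType) n (u : 'cV[R]_n) (v : K -> 'cV[R]_n) :
  dot u (\sum_k v k) = \sum_k dot u (v k).
Proof. by rewrite /dot mulmx_sumr summxE. Qed.

Lemma dot_le n (s u v : 'cV[R]_n) : vle 0 s -> vle u v -> dot s u <= dot s v.
Proof.
move=> s_ge0 uv; rewrite !dotE; apply: ler_sum => i _.
by apply: ler_wpM2l (uv i); have := s_ge0 i; rewrite mxE.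
Qed.

Variables (K : finType) (m : nat) (M : market R K m).

(** Decisions are flattened into functions on pairs (participant, variable), so that they form a
    module to which [farkas] applies. *)
Let coordinates := {ffun {k : K & 'I_(nvar M k)} -> R^o}.

Let of_coordinates (v : coordinates) : decision M :=
  fun k => \col_i v (Tagged (fun k => 'I_(nvar M k)) i).

Let of_coordinates_linear a u v k :
  of_coordinates (a *: u + v) k = a *: of_coordinates u k + of_coordinates v k.
Proof. by apply/colP => i; rewrite !mxE !ffunE. Qed.

Let of_coordinates0 k : of_coordinates 0 k = 0.
Proof. by apply/colP => i; rewrite !mxE !ffunE. Qed.

Let welfare_linear a (x y z : decision M) :
  (forall k, z k = a *: x k + y k) -> welfare M z = a * welfare M x + welfare M y.
Proof.
move=> zE; rewrite /welfare mulr_sumr -big_split/=.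
by apply: eq_bigr => k _; rewrite zE dot_is_scalar.
Qed.

Let balance_linear a (x y z : decision M) :
  (forall k, z k = a *: x k + y k) ->
  \sum_k mx_A M k *m z k =
    a *: (\sum_k mx_A M k *m x k) + \sum_k mx_A M k *m y k.
Proof.
move=> zE; rewrite scaler_sumr -big_split/=.
by apply: eq_bigr => k _; rewrite zE mulmxDr -scalemxAr.
Qed.

(** For [t > 0], rescaling [y] by [t^-1] gives a feasible decision. For [t = 0], [y] is a recession
    direction: adding it to [x] keeps feasibility, so it cannot increase welfare. *)
Lemma homogenised_welfare_le (x y : decision M) (t : R) :
    is_max (welfare M) (welfare_feasible M) x -> 0 <= t -> balanced M y ->
    (forall k, vle (mx_B M k *m y k) (t *: rhs_b M k)) ->
  welfare M y <= t * welfare M x.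
Proof.
move=> [[xbal xfeas] xmax]; rewrite le0r => /predU1P[->|t_gt0] ybal yfeas.
  pose z k := 1 *: y k + x k.
  have : welfare M z <= welfare M x.
    apply: xmax; split=> [|k i].
      by rewrite /balanced (@balance_linear 1 y x) // ybal xbal scaler0 addr0.
    rewrite /z scale1r mulmxDr mxE.
    have := xfeas k i; have := yfeas k i.
    by rewrite scale0r [X in _ <= X -> _]mxE; lra.
  by rewrite (@welfare_linear 1 y x) //; lra.
(* The summand [0] gives [z] the shape that [balance_linear] and [welfare_linear] expect. *)
pose z k := t^-1 *: y k + 0 : 'cV_(nvar M k).
have w0 : welfare M (fun=> 0) = 0.
  by apply: big1 => k _; rewrite dotr0.
have A0 : \sum_k mx_A M k *m (0 : 'cV_(nvar M k)) = 0.
  by apply: big1 => k _; rewrite mulmx0.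
have : welfare M z <= welfare M x.
  apply: xmax; split=> [|k i].
    by rewrite /balanced (@balance_linear t^-1 y (fun=> 0)) // ybal A0 scaler0 addr0.
  rewrite /z addr0 -scalemxAr mxE mulrC ler_pdivrMr// mulrC.
  by have := yfeas k i; rewrite [X in _ <= X -> _]mxE.
rewrite (@welfare_linear t^-1 y (fun=> 0)) // w0 addr0.
by rewrite mulrC ler_pdivrMr// mulrC.
Qed.

(** Linear forms that agree everywhere have equal coefficients: the residual [e] of the dual
    equations is orthogonal to every decision, hence to itself, and a vanishing sum of squares has
    vanishing terms. *)
Lemma dual_feasible_of_coordinates (p : 'cV[R]_m) (s : multiplier M) :
    (forall k, vle 0 (s k)) ->
    (forall v : coordinates, welfare M (of_coordinates v) =
       dot p (\sum_k mx_A M k *m of_coordinates v k)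
       + \sum_k dot (s k) (mx_B M k *m of_coordinates v k)) ->
  dual_feasible M (p, s).
Proof.
move=> s_ge0 E k; split=> //; apply/esym/eqP; rewrite -subr_eq0; apply/eqP.
pose e k := coef_c M k - ((mx_A M k)^T *m p + (mx_B M k)^T *m s k).
have dot_e v : \sum_k dot (e k) (of_coordinates v k) = 0.
  have cE j : coef_c M j = e j + ((mx_A M j)^T *m p + (mx_B M j)^T *m s j).
    by rewrite subrK.
  move: (E v); rewrite dot_sumr -big_split/= /welfare.
  under [X in X = _ -> _]eq_bigr do rewrite cE (dotDl _ (e _)) (dotDl _ (_ *m _)) !dot_trmx.
  by rewrite big_split/= -[RHS]add0r => /addIr.
have /eqP := dot_e [ffun u => e (tag u) (tagged u) 0].
have dot_ee j : dot (e j) (of_coordinates [ffun u => e (tag u) (tagged u) 0] j)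
    = \sum_i e j i 0 ^+ 2.
  by rewrite dotE; apply: eq_bigr => i _; rewrite [X in _ * X]mxE ffunE expr2.
rewrite (eq_bigr _ (fun j _ => dot_ee j)) psumr_eq0; last first.
  by move=> j _; apply: sumr_ge0 => i _; apply: sqr_ge0.
move=> /allP /(_ k (mem_index_enum k)) /=.
rewrite psumr_eq0 => [/allP e0|i _]; last exact: sqr_ge0.
apply/colP => i; have := e0 i (mem_index_enum i); rewrite /= sqrf_eq0.
by move=> /eqP ->; rewrite mxE.
Qed.

Theorem strong_duality (x : decision M) :
    is_max (welfare M) (welfare_feasible M) x ->
  exists2 d, dual_feasible M d & dual_objective M d <= welfare M x.
Proof.
move=> x_max; pose w := welfare M x.
pose bal (v : coordinates) := \sum_k mx_A M k *m of_coordinates v k.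
(* In order: [0 <= t], the private constraints, and each balance equation as two opposite
   inequalities. *)
pose J := (unit + ({k : K & 'I_(ncon M k)} + ('I_m + 'I_m)))%type.
pose a (j : J) (z : coordinates * R^o) : R :=
  match j with
  | inl _ => - z.2
  | inr (inl u) => (mx_B M (tag u) *m of_coordinates z.1 (tag u)) (tagged u) 0
                   - z.2 * rhs_b M (tag u) (tagged u) 0
  | inr (inr (inl i)) => bal z.1 i 0
  | inr (inr (inr i)) => - bal z.1 i 0
  end.
have balL b u v : bal (b *: u + v) = b *: bal u + bal v.
  exact/balance_linear/of_coordinates_linear.
have [|||l l_ge0 E] := @farkas R (coordinates * R^o)%type J a
    (fun z => welfare M (of_coordinates z.1) - z.2 * w).
- move=> j b [u t] [v t']; case: j => [?|[[k i]|[i|i]]] /=.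
  + by rewrite /GRing.scale/=; ring.
  + by rewrite of_coordinates_linear mulmxDr -scalemxAr !mxE /GRing.scale/=; ring.
  + by rewrite balL !mxE.
  + by rewrite balL !mxE; ring.
- move=> b [u t] [v t'] /=.
  rewrite (@welfare_linear b (of_coordinates u) (of_coordinates v)).
    by rewrite /GRing.scale/=; ring.
  exact: of_coordinates_linear.
- move=> [v t] av_le0 /=; rewrite subr_le0.
  apply: homogenised_welfare_le => //.
  + by have := av_le0 (inl tt); rewrite /= oppr_le0.
  + apply/colP => i; rewrite [RHS]mxE.
    have := av_le0 (inr (inr (inl i))); have := av_le0 (inr (inr (inr i))).
    by rewrite /= /bal; lra.
  + move=> k i; have := av_le0 (inr (inl (Tagged _ i))).
    by rewrite /= subr_le0 [X in _ -> _ <= X]mxE.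
(* Prices are differences of the multipliers of opposite inequalities, hence free in sign. *)
pose p : 'cV[R]_m := \col_i (l (inr (inr (inl i))) - l (inr (inr (inr i)))).
pose s : multiplier M := fun k => \col_i l (inr (inl (Tagged _ i))).
have s_ge0 k : vle 0 (s k) by move=> i; rewrite !mxE.
have {}E v t : welfare M (of_coordinates v) - t * w =
    dot p (bal v) + \sum_k dot (s k) (mx_B M k *m of_coordinates v k)
    - t * (l (inl tt) + dual_objective M (p, s)).
  rewrite (E (v, t)) !big_sumType/= (big_pred1 tt); last by case.
  have -> : dot p (bal v) = \sum_i l (inr (inr (inl i))) * bal v i 0
      + \sum_i l (inr (inr (inr i))) * - bal v i 0.
    by rewrite dotE -big_split/=; apply: eq_bigr => i _; rewrite mxE; ring.
  have -> : \sum_k dot (s k) (mx_B M k *m of_coordinates v k) =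
      \sum_u l (inr (inl u)) * ((mx_B M (tag u) *m of_coordinates v (tag u))
          (tagged u) 0 - t * rhs_b M (tag u) (tagged u) 0)
      + t * dual_objective M (p, s).
    apply/eqP; rewrite -subr_eq mulr_sumr -sumrB; apply/eqP.
    pose F k (i : 'I_(ncon M k)) := s k i 0 *
      ((mx_B M k *m of_coordinates v k) i 0 - t * rhs_b M k i 0).
    transitivity (\sum_k \sum_i F k i).
      apply: eq_bigr => k _; rewrite !dotE mulr_sumr -sumrB.
      by apply: eq_bigr => i _; rewrite /F; ring.
    rewrite sig_big_dep.
    by apply: eq_bigr => -[k i] _; rewrite /F [s _ _ _]mxE.
  ring.
(* Setting [t = 0] in [E] leaves the identity that gives dual feasibility. *)
exists (p, s).
  apply: dual_feasible_of_coordinates => // v.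
  by have := E v 0; rewrite !mul0r !subr0.
have w0 : welfare M (of_coordinates 0) = 0.
  by apply: big1 => k _; rewrite of_coordinates0 dotr0.
have bal0 : bal 0 = 0 by apply: big1 => k _; rewrite of_coordinates0 mulmx0.
(* At [v = 0], [t = 1], [E] says that [w] exceeds the dual value by the multiplier of [0 <= t],
   which is nonnegative. *)
have := E 0 1; rewrite w0 bal0 dotr0 big1 => [|k _]; last first.
  by rewrite of_coordinates0 mulmx0 dotr0.
by have := l_ge0 (inl tt); rewrite -/w; lra.
Qed.

End Duality.

Theorem theoremA1 (R : realType) (K : finType) (m : nat) (M : market R K m)
  (welfare_nonempty : welfare_feasible M !=set0)
  (welfare_bounded : bounded_decisions M (welfare_feasible M))
  (private_nonempty : forall k, private_feasible M k !=set0)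
  (private_bounded : forall k, bounded_set (private_feasible M k))
  (x : decision M) (p : 'cV[R]_m)
  (x_optimal : is_max (welfare M) (welfare_feasible M) x)
  (p_optimal : optimal_balance_dual M p) :
  competitive_equilibrium M x p.
Proof.
have [[xbal xfeas] _] := x_optimal.
have [s [ps_feas ps_min]] := p_optimal.
have [d d_feas d_le] := strong_duality _ _ _ _ _ x_optimal.
have ps_le : dual_objective M (p, s) <= welfare M x.
  exact: le_trans (ps_min d d_feas) d_le.
(* The gap in weak duality for participant [k]: nonnegative for each [k], but of sum at most [0]. *)
pose slack k := dot (rhs_b M k) (s k) - participant_profit M p k (x k).
have profit_le k y : private_feasible M k y ->
    participant_profit M p k y <= dot (rhs_b M k) (s k).
  move=> yfeas; have [cE s_ge0] := ps_feas k.
  rewrite /participant_profit -cE dotDl !dot_trmx addrAC subrr add0r.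
  by rewrite [leRHS]dotC; apply: dot_le.
have slack_ge0 k : 0 <= slack k by rewrite subr_ge0; apply: profit_le.
have sum_slack : \sum_k slack k <= 0.
  (* The payments add up to [dot p] of the total balance, which is zero, so only the dual value
     minus the welfare remains. *)
  rewrite sumrB [X in _ - X]sumrB -dot_sumr.
  by rewrite [X in dot p X]xbal dotr0 subr0 subr_le0.
have slack0 k : slack k = 0.
  apply/eqP; move: sum_slack; rewrite le_eqVlt ltNge sumr_ge0// orbF.
  by rewrite psumr_eq0// => /allP /(_ k (mem_index_enum k)).
split=> // k; split=> // y /profit_le.
by have := slack0 k; rewrite /slack; lra.
Qed.
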